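(* Let $p$ be a prime with $p\equiv 2\pmod 3$, let $m_p=(p+1)/3$, and let $n\in\mathbb{N}$. If $A\subset\mathbb{F}_p^n$ is sum-free and $|A|\ge (m_p-1/2+1/p)p^{n-1}$, then $A$ is normal, i.e. there exist a subspace $V<\mathbb{F}_p^n$ of co-dimension $1$ and $w\in\mathbb{F}_p^n\setminus V$ with $A\subset\{m_pw,(m_p+1)w,\ldots,(2m_p-1)w\}+V$.
   Context: A set $A\subset\mathbb{F}_p^n$ is sum-free if there are no $a,b,c\in A$ with $a+b=c$. *)

(* Defs.v *)
From HB Require Import structures.
From mathcomp Require Import all_boot all_order all_algebra.

Set Implicit Arguments.
Unset Strict Implicit.
Unset Printing Implicit Defensive.

Import GRing.Theory.
Local Open Scope ring_scope.

Definition sum_free (T : finZmodType) (A : {set T}) : Prop :=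
  ~ exists a b c : T, [/\ a \in A, b \in A, c \in A & a + b = c].

(* The division is exact when p = 2 modulo 3. *)
Definition m_ (p : nat) : nat := (p.+1 %/ 3)%N.

(* A is covered by the cosets k w + V, m_p <= k <= 2 m_p - 1, of a hyperplane
   V; the upper bound on k is written k < 2 m_p. *)
Definition normal_set (p n : nat) (A : {set 'rV['F_p]_n}) : Prop :=
  exists (V : {vspace 'rV['F_p]_n}) (w : 'rV['F_p]_n),
    [/\ (\dim V).+1 = n, w \notin V
      & forall a, a \in A ->
        exists (k : nat) (v : 'rV['F_p]_n),
          [/\ (m_ p <= k < 2 * m_ p)%N, v \in V & a = w *+ k + v]].

(* Main.v *)
Require Import Defs.
From HB Require Import structures.
From mathcomp Require Import all_boot all_order all_algebra.
From mathcomp Require Import all_fingroup all_solvable all_field zify ring lra.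

Set Implicit Arguments.
Unset Strict Implicit.
Unset Printing Implicit Defensive.

Import Order.TTheory GRing.Theory Num.Theory.

(* For a nonzero linear functional u on F_p^n let a_i be the density of A in
   the coset {u = i} of the hyperplane ker u.

   Counting solutions of u(x) + u(y) = u(z) in A^3, summed over all u, against
   the pairs with u(x) = u(y) gives a functional and a coset of density
   t >= alpha / (1 - alpha), where alpha is the density of A.

   Fix this u.  If a_i, a_j, a_{i+j} > 0, then Mann's addition theorem in ker u
   gives a_i + a_j + a_{i+j} <= 1 + 1/p, and if a_i + a_j > 1 then
   a_{i+j} = 0.  Sort the values as b_1 >= ... >= b_p, with F of them positive.
   By Cauchy-Davenport any three ranks x + y + z >= p + 2 are realised by a
   triple (i, j, i + j).  Taking z = F bounds b_x + b_y by 1, and taking z = 1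
   bounds it by 1 + 1/p - t.  If the support of a contained a triple
   (i, j, i + j), summing these bounds would contradict the size of A.

   So the support is a sum-free subset of F_p with at least m_p elements, and
   Vosper's theorem shows that it is {m_p k, ..., (2 m_p - 1) k} for some k. *)

(** * Addition theorems in abelian groups *)

Lemma lex_leq (k u v x y : nat) : x <= k -> y <= k ->
  u * k.+1 + x <= v * k.+1 + y -> u <= v /\ (y < x -> u < v).
Proof.
move=> xk yk h; split; last move=> yx; rewrite leqNgt; apply/negP => vu.
  by have := leq_mul vu (leqnn k.+1); lia.
by have := leq_mul vu (leqnn k.+1); lia.
Qed.

Ltac card_lia := clear; repeat match goal with
  | |- context [#|?A|] => let n := fresh "n" in move: #|A| => n end; lia.

Section Mann.
Local Open Scope group_scope.
Variables (gT : finGroupType) (K : {group gT}).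
Hypothesis abK : abelian K.

Lemma leq_card_mulr (S X : {set gT}) : S != set0 -> #|X| <= #|S * X|.
Proof.
case/set0Pn=> s sS; rewrite -(card_lcoset X s) subset_leq_card //.
by rewrite mulSg // sub1set.
Qed.

Lemma mann_addition (S T : {set gT}) :
    S \subset K -> T \subset K -> S != set0 -> T != set0 -> S * T != K ->
  exists2 H : {group gT}, H \proper K & #|S| + #|T| <= #|S * T| + #|H|.
Proof.
move=> sSK sTK S0 T0 STK.
pose frag (X : {set gT}) := [&& X \subset K, X != set0 & S * X != K].
(* [mu] orders fragments by [#|S * X| - #|X|] first and by [#|X|] second. *)
pose mu (X : {set gT}) := ((#|(S * X)%g| - #|X|) * #|K|.+1 + #|X|)%N.
have fT : frag T by rewrite /frag sTK T0.
have leS (X : {set gT}) : #|X| <= #|S * X| by exact: leq_card_mulr.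
case: (@arg_minnP {set gT} T frag mu fT) => X0 fX0 minX0.
have cardK (X : {set gT}) : frag X -> #|X| <= #|K|.
  by case/and3P=> sXK _ _; exact: subset_leq_card.
have mulJ (X : {set gT}) x : x \in K -> X \subset K -> S * (x *: X) = x *: (S * X).
  move=> xK sXK; rewrite !mulgA; congr (_ * _).
  apply: centC; apply: subset_trans sSK _.
  by rewrite sub_abelian_cent ?sub1set.
have fragJ (X : {set gT}) x : x \in K -> frag X -> frag (x *: X).
  move=> xK /and3P[sXK X_0 SXK]; apply/and3P; split.
  - by rewrite mul_subG // sub1set.
  - by rewrite -card_gt0 card_lcoset card_gt0.
  - rewrite mulJ //; apply: contra SXK => /eqP e.
    by rewrite eqEcard mul_subG //= -(card_lcoset (S * X) x) e.
have muJ (X : {set gT}) x : x \in K -> X \subset K -> mu (x *: X) = mu X.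
  by move=> xK sXK; rewrite /mu mulJ // !card_lcoset.
have [x0 x0X] : exists x, x \in X0 by apply/set0Pn; case/and3P: fX0.
have sX0K : X0 \subset K by case/and3P: fX0.
have x0K : x0 \in K by exact: (subsetP sX0K).
have [X defX] : {X | X = x0^-1 *: X0} by exists (x0^-1 *: X0).
have fX : frag X by rewrite defX; apply: fragJ; rewrite ?groupV.
have minX (Y : {set gT}) : frag Y -> mu X <= mu Y by rewrite defX muJ ?groupV //; exact: minX0.
have X1 : 1 \in X by rewrite defX mem_lcoset invgK mulg1.
have [sXK X_0 SXK] := and3P fX.
have minD (Y : {set gT}) : frag Y -> #|S * X| + #|Y| <= #|S * Y| + #|X|.
  move=> fY; have [] := lex_leq (cardK _ fX) (cardK _ fY) (minX _ fY).
  by move: (leS X) (leS Y); card_lia.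
have minC (Y : {set gT}) : frag Y -> #|Y| < #|X| -> #|S * X| + #|Y| < #|S * Y| + #|X|.
  move=> fY ltYX; have [_ /(_ ltYX)] := lex_leq (cardK _ fX) (cardK _ fY) (minX _ fY).
  by move: (leS X) (leS Y); card_lia.
have subSX (Y : {set gT}) : Y \subset K -> S * Y \subset K by exact: mul_subG.
have cardSX (Y : {set gT}) : frag Y -> #|S * Y| < #|K|.
  by case/and3P=> sYK _ SYK; apply: proper_card; rewrite properEneq SYK subSX.
(* The inverse of the complement of [S * X] is again a minimal fragment. *)
have XltK : #|X| + #|S * X| <= #|K|.
  pose Z := [set z in K | z^-1 \notin S * X].
  have cZ : #|Z| = #|K| - #|S * X|.
    have -> : Z = (K :\: S * X)^-1.
      by apply/setP=> z; rewrite !inE groupV andbC.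
    by rewrite card_invg cardsD (setIidPr (subSX _ sXK)).
  have sZK : Z \subset K by apply/subsetP=> z; rewrite inE => /andP[].
  have dis : S * Z \subset K :\: X^-1.
    apply/subsetP=> _ /mulsgP[s z sS + ->]; rewrite inE => /andP[zK zSX].
    have sK := subsetP sSK _ sS.
    rewrite !inE groupM // andbT; apply: contra zSX => h.
    have -> : z^-1 = s * (s * z)^-1.
      by rewrite (centsP abK s _ z) // invMg mulKVg.
    by rewrite mem_mulg.
  have cSZ : #|S * Z| <= #|K| - #|X|.
    have /subset_leq_card := dis; rewrite cardsD (setIidPr _) ?card_invg //.
    by rewrite -(invGid K) invSg.
  have fZ : frag Z.
    rewrite /frag sZK -card_gt0 cZ subn_gt0 cardSX //=; apply/eqP => e.
    by move: cSZ X_0 (cardK _ fX); rewrite e -card_gt0; card_lia.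
  move: (minC _ fZ) cSZ X_0 (cardSX _ fX) (cardK _ fX).
  by rewrite cZ -card_gt0; card_lia.
(* Submodularity of [X |-> #|S * X|] forces two minimal fragments that meet
   to coincide, provided that their union is still a fragment. *)
have Xgroup x : x \in X -> x^-1 *: X = X.
  move=> xX; have [Y defY] : {Y | Y = x^-1 *: X} by exists (x^-1 *: X).
  rewrite -defY.
  have xK : x^-1 \in K by rewrite groupV (subsetP sXK).
  have fY : frag Y by rewrite defY; exact: fragJ.
  have sYK : Y \subset K by case/and3P: fY.
  have cY : #|Y| = #|X| by rewrite defY card_lcoset.
  have cSY : #|S * Y| = #|S * X| by rewrite defY mulJ // card_lcoset.
  have [/eqP // | nYX] := boolP (Y == X).
  have Y1 : 1 \in Y by rewrite defY mem_lcoset invgK mulg1.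
  have fI : frag (X :&: Y).
    rewrite /frag subIset ?sXK //=; apply/andP; split.
      by apply/set0Pn; exists 1; rewrite inE X1.
    apply: contra SXK => /eqP e; rewrite eqEsubset subSX //= -{1}e mulgS //.
    exact: subsetIl.
  have ltI : #|X :&: Y| < #|X|.
    apply: proper_card; rewrite properEneq subsetIl andbT.
    apply: contra nYX => /eqP/setIidPl sXY; rewrite eq_sym eqEcard cY leqnn andbT.
    exact: sXY.
  have lI := minC _ fI ltI.
  have sIS : S * (X :&: Y) \subset (S * X) :&: (S * Y).
    by rewrite subsetI !mulgS ?subsetIl ?subsetIr.
  have := subset_leq_card sIS => cIS.
  have := cardsUI (S * X) (S * Y); rewrite -mulgU cSY => cUI.
  have cUIX := cardsUI X Y.
  have fU : frag (X :|: Y).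
    rewrite /frag subUset sXK sYK /=; apply/andP; split.
      by apply/set0Pn; exists 1; rewrite inE X1.
    apply/eqP=> e; move: cUI; rewrite e.
    have I0 : 0 < #|X :&: Y| by rewrite card_gt0; case/and3P: fI.
    by move: XltK cIS cUIX lI cY I0; card_lia.
  by move: (minD _ fU) cUI cIS cUIX lI cY; card_lia.
have gX : group_set X.
  apply/group_setP; split=> // x y xX yX.
  have : y \in x^-1 *: X by rewrite Xgroup.
  by rewrite mem_lcoset invgK.
exists (Group gX) => /=.
  rewrite properEneq sXK andbT; apply: contra SXK => /eqP e.
  case/set0Pn: S0 => s sS; rewrite eqEsubset subSX //= e.
  by rewrite -{1}(lcoset_id (subsetP sSK _ sS)) mulSg ?sub1set.
have : #|S| <= #|S * X| by apply: subset_leq_card; exact: mulg_subl.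
by move: (minD _ fT); card_lia.
Qed.
End Mann.

Section Cosets.
Local Open Scope group_scope.
Variables (gT : finGroupType) (p : nat) (K : {group gT}).

Lemma pgroup_proper_card (H : {group gT}) : prime p ->
  p.-group K -> H \proper K -> (p * #|H| <= #|K|)%N.
Proof.
move=> p_pr pK ltHK; have sHK := proper_sub ltHK.
rewrite mulnC -(Lagrange sHK) leq_mul2l; apply/orP; right.
have : p.-nat #|K : H| by apply: pnat_dvd pK; exact: dvdn_indexg.
case/p_natP=> [[|k] e]; first by move: (proper_subn ltHK); rewrite -indexg_gt1 e.
by rewrite e expnS leq_pmulr // expn_gt0 prime_gt0.
Qed.

Hypothesis abT : abelian [set: gT].

Let mulC (x y : gT) : x * y = y * x.
Proof. by apply: (centsP abT); rewrite inE. Qed.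

Lemma coset_triple_card (x y : gT) (X Y Z : {set gT}) : prime p -> p.-group K ->
    X \subset x *: K -> Y \subset y *: K -> Z \subset (x * y) *: K ->
    X != set0 -> Y != set0 -> Z != set0 ->
    {in X & Y, forall u v, u * v \notin Z} ->
  (p * (#|X| + #|Y| + #|Z|) <= p.+1 * #|K|)%N.
Proof.
move=> p_pr pK sX sY sZ X0 Y0 Z0 disj.
have abK : abelian K by apply: abelianS abT; exact: subsetT.
have sub z (U : {set gT}) : U \subset z *: K -> z^-1 *: U \subset K.
  move=> sU; apply/subsetP=> w; rewrite mem_lcoset invgK => /(subsetP sU).
  by rewrite mem_lcoset mulKg.
have n0 z (U : {set gT}) : U != set0 -> z^-1 *: U != set0.
  by rewrite -!card_gt0 card_lcoset.
pose X' := x^-1 *: X; pose Y' := y^-1 *: Y; pose Z' := (x * y)^-1 *: Z.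
have disj' : X' * Y' \subset K :\: Z'.
  rewrite subsetD mul_subG ?sub //=; apply/pred0P => w /=; apply/negbTE/negP.
  case/andP=> /mulsgP[u v + + ->]; rewrite !mem_lcoset !invgK => uX vY.
  have -> : x * y * (u * v) = x * u * (y * v).
    by rewrite !mulgA -(mulgA x y) (mulC y) mulgA.
  by move=> h; move: (disj _ _ uX vY); rewrite h.
have cZ : #|Z'| = #|Z| by rewrite card_lcoset.
have le1 := subset_leq_card disj'.
rewrite cardsD (setIidPr (sub _ _ sZ)) cZ in le1.
have ZK : (#|Z| <= #|K|)%N by rewrite -cZ subset_leq_card ?sub.
have nK : X' * Y' != K.
  apply/eqP=> e; rewrite e in le1; move: Z0; rewrite -card_gt0.
  by move: le1 (cardG_gt0 K); card_lia.
have [H ltHK] := mann_addition abK (sub _ _ sX) (sub _ _ sY) (n0 _ _ X0) (n0 _ _ Y0) nK.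
rewrite !card_lcoset => h; have := pgroup_proper_card p_pr pK ltHK.
have : (#|X| + #|Y| + #|Z| <= #|K| + #|H|)%N by move: le1 ZK h; card_lia.
move=> le leH; apply: leq_trans (leq_mul (leqnn p) le) _.
by rewrite mulnDr mulSn addnC leq_add2r.
Qed.

Lemma coset_pigeonhole (x y z : gT) (X Y : {set gT}) :
    X \subset x *: K -> Y \subset y *: K -> z \in (x * y) *: K ->
    (#|K| < #|X| + #|Y|)%N ->
  exists u v, [/\ u \in X, v \in Y & u * v = z].
Proof.
move=> sX sY zK ltK.
pose Y' := [set z * v^-1 | v in Y].
have cY : #|Y'| = #|Y| by rewrite card_imset // => u v /mulgI/invg_inj.
have sY' : Y' \subset x *: K.
  apply/subsetP=> _ /imsetP[v /(subsetP sY) + ->].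
  move: zK; rewrite !mem_lcoset invMg => zK vK.
  have -> : x^-1 * (z * v^-1) = (y^-1 * v)^-1 * (y^-1 * x^-1 * z).
    by rewrite invMg invgK !mulgA mulgK -(mulgA v^-1) (mulC v^-1).
  by rewrite groupM // groupV.
have : X :&: Y' != set0.
  rewrite -card_gt0; move: (cardsUI X Y') ltK; rewrite cY.
  have : X :|: Y' \subset x *: K by rewrite subUset sX.
  by move/subset_leq_card; rewrite card_lcoset; card_lia.
case/set0Pn=> u; rewrite inE => /andP[uX /imsetP[v vY e]].
by exists u, v; split=> //; rewrite e mulgKV.
Qed.
End Cosets.

Local Open Scope ring_scope.

Section CauchyDavenport.
Variable p : nat.
Hypothesis p_pr : prime p.
Implicit Types X Y Z : {set 'F_p}.

Lemma cauchy_davenport X Y : X != set0 -> Y != set0 ->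
  (X * Y)%g != setT -> (#|X| + #|Y| <= #|(X * Y)%g| + 1)%N.
Proof.
move=> X0 Y0 nT.
have [H ltH h] := mann_addition (FinRing.zmod_abelian [set: 'F_p]) (subsetT X) (subsetT Y) X0 Y0 nT.
have pT : (p.-group [set: 'F_p])%g by rewrite /pgroup cardsT card_Fp ?pnat_id.
have := pgroup_proper_card p_pr pT ltH; rewrite cardsT card_Fp // => h2.
have : (#|H| <= 1)%N by rewrite -(leq_pmul2l (prime_gt0 p_pr)) muln1.
by move: h; card_lia.
Qed.

Lemma cauchy_davenport_triple X Y Z : X != set0 -> Y != set0 -> Z != set0 ->
  (p.+1 < #|X| + #|Y| + #|Z|)%N ->
  exists x y, [/\ x \in X, y \in Y & x + y \in Z].
Proof.
move=> X0 Y0 Z0 lt.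
have pT : (p.-group [set: 'F_p])%g by rewrite /pgroup cardsT card_Fp ?pnat_id.
have [|dis] := boolP [exists x in X, exists y in Y, x + y \in Z].
  by case/exists_inP=> x xX /exists_inP[y yY h]; exists x, y.
have sT (U : {set 'F_p}) x : U \subset (x *: [set: 'F_p])%g.
  by apply/subsetP=> u _; rewrite mem_lcoset inE.
have := @coset_triple_card _ p [group of [set: 'F_p]] (FinRing.zmod_abelian _)
  0 0 X Y Z p_pr pT (sT _ _) (sT _ _) (sT _ _) X0 Y0 Z0.
rewrite cardsT card_Fp // => H; suff : (p * (#|X| + #|Y| + #|Z|) <= p.+1 * p)%N.
  by rewrite mulnC leq_pmul2r ?prime_gt0 // leqNgt lt.
apply: H => u v uX vY; apply: contra dis => h.
by apply/exists_inP; exists u => //; apply/exists_inP; exists v.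
Qed.
End CauchyDavenport.

(** * Vosper's theorem and sum-free sets in F_p *)

Section Vosper.
Variable p : nat.
Hypothesis p_pr : prime p.
Implicit Types A B C X Y : {set 'F_p}.

Definition shift (t : 'F_p) A : {set 'F_p} := [set x | x - t \in A].

Lemma card_shift t A : #|shift t A| = #|A|.
Proof.
rewrite -(card_preimset A (f := fun x => x - t)) //; exact: addIr.
Qed.

Lemma mem_sumset A B x y : x \in A -> y \in B -> x + y \in (A * B)%g.
Proof. exact: mem_mulg. Qed.

Lemma sumsetP A B z :
  reflect (exists x y, [/\ x \in A, y \in B & z = x + y]) (z \in (A * B)%g).
Proof.
apply: (iffP mulsgP) => [[x y xA yB ->]|[x [y [xA yB ->]]]]; first by exists x, y.
by exists x y.
Qed.

Definition ends (k : 'F_p) C : {set 'F_p} := [set x in C | x + k \notin C].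

Lemma ends_neq0 k C : k != 0 -> C != set0 -> C != setT -> ends k C != set0.
Proof.
move=> k0 C0 CT; apply/set0Pn; have [/existsP//|] := boolP [exists x, x \in ends k C].
rewrite negb_exists => /forallP noend.
have sC : (C * [set 0; k])%g \subset C.
  apply/subsetP=> z /sumsetP[x [y [xC]]]; rewrite !inE => /orP[]/eqP-> ->.
    by rewrite addr0.
  by have := noend x; rewrite inE xC negbK.
have kk : [set 0; k] != set0 :> {set 'F_p} by apply/set0Pn; exists 0; rewrite !inE eqxx.
have nT : (C * [set 0; k])%g != setT.
  by apply: contra CT => /eqP e; rewrite e subTset in sC.
have := cauchy_davenport p_pr C0 kk nT; rewrite cards2 eq_sym k0.
by move: (subset_leq_card sC); card_lia.
Qed.

Lemma vosper_sumset A B : (1 < #|A|)%N -> (1 < #|B|)%N ->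
    #|(A * B)%g|.+1 = (#|A| + #|B|)%N -> (#|(A * B)%g|.+1 < p)%N ->
  exists2 k, k != 0 & (#|ends k (A * B)%g| <= 1)%N.
Proof.
have [n] := ubnP #|B|; elim: n A B => // n IH A B ltB A2 B2 crit small.
have [B3|B3] := ltnP 2 #|B|; last first.
  have /cards2P[u [v [uv eB]]] : #|B| == 2%N by rewrite eqn_leq B3.
  exists (v - u); first by rewrite subr_eq0 eq_sym.
  have eAB : (A * B)%g = shift u A :|: shift v A.
    apply/setP=> z; rewrite !inE eB; apply/sumsetP/orP => [[x [y [xA]]]|[] h].
    - by rewrite !inE => /orP[]/eqP-> ->; rewrite addrK; [left|right].
    - by exists (z - u), u; rewrite h !inE eqxx subrK.
    - by exists (z - v), v; rewrite h !inE eqxx orbT subrK.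
  apply: leq_trans (_ : #|shift v A :\: shift u A| <= 1)%N.
    apply/subset_leq_card/subsetP=> x; rewrite eAB !inE => /andP[h].
    have -> : x + (v - u) - v = x - u by ring.
    rewrite negb_or => /andP[_ n1].
    by move: h; rewrite (negPf n1).
  move: crit; rewrite eAB (_ : #|B| = 2%N); last by rewrite eB cards2 uv.
  move: (cardsUI (shift u A) (shift v A)).
  move: (cardsID (shift u A) (shift v A)); rewrite setIC !card_shift.
  by card_lia.
have B0 : B != set0 by rewrite -card_gt0; apply: ltn_trans B2.
have [b0 b0B] := set0Pn _ B0.
(* Dyson's e-transform of the pair [(A, B)]. *)
pose Ae e := A :|: shift (e - b0) B; pose Be e := B :&: shift (b0 - e) A.
have subAe e : (Ae e * Be e)%g \subset (A * B)%g.
  apply/subsetP=> z /sumsetP[x [y [+ + ->]]]; rewrite !inE => /orP[xA|xB] /andP[yB yA].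
    exact: mem_sumset.
  have -> : x + y = (y - (b0 - e)) + (x - (e - b0)).
    by ring.
  exact: mem_sumset.
have cAe e : (#|Ae e| + #|Be e| = #|A| + #|B|)%N.
  have -> : #|Be e| = #|A :&: shift (e - b0) B|.
    rewrite -(card_shift (e - b0)); apply: eq_card => x; rewrite !inE andbC.
    by congr (_ && _); congr (_ \in A); ring.
  by rewrite cardsUI card_shift.
have Be0 e : e \in A -> b0 \in Be e.
  by move=> eA; rewrite !inE b0B /= opprB addrCA subrr addr0.
have ltAB C : C \subset (A * B)%g -> C != setT.
  move=> sC; apply/eqP=> eC; have := subset_leq_card sC.
  by rewrite eC cardsT card_Fp // leqNgt (ltn_trans (ltnSn _)).
have [/exists_inP[e eA /andP[e2 eB]]|] :=
    boolP [exists e in A, (1 < #|Be e|) && (#|Be e| < #|B|)]%N.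
  have Be_n0 : Be e != set0 by apply/set0Pn; exists b0; exact: Be0.
  have Ae2 : (1 < #|Ae e|)%N by apply: leq_trans A2 _; rewrite subset_leq_card ?subsetUl.
  have Ae_n0 : Ae e != set0 by rewrite -card_gt0; exact: ltn_trans Ae2.
  have cd := cauchy_davenport p_pr Ae_n0 Be_n0 (ltAB _ (subAe e)).
  have eqAB : (Ae e * Be e)%g = (A * B)%g.
    apply/eqP; rewrite eqEcard subAe /=.
    by move: cd crit; rewrite cAe; card_lia.
  rewrite -eqAB; apply: IH => //; rewrite ?eqAB ?cAe //.
  by apply: leq_trans eB _; rewrite -ltnS.
rewrite negb_exists_in => /forall_inP nogood; exfalso.
pose Y := [set e in A | B \subset shift (b0 - e) A]; pose X := A :\: Y.
have B1 e : e \in X -> Be e = [set b0].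
  rewrite !inE => /andP[+ eA]; rewrite eA /= => eY.
  have ltBe : (#|Be e| < #|B|)%N.
    apply: proper_card; rewrite properEneq subsetIl andbT.
    by apply: contra eY => /eqP/setIidPl.
  have := nogood _ eA; rewrite ltBe andbT -leqNgt => le1.
  apply/esym/eqP; rewrite eqEcard sub1set Be0 //=.
  by rewrite cards1.
have cXY : (#|X| + #|Y| = #|A|)%N.
  rewrite addnC -(cardsID Y A) (setIidPr _) //.
  by apply/subsetP=> y; rewrite inE => /andP[].
pose D := B :\ b0.
have cD : #|B| = #|D|.+1 by rewrite (cardsD1 b0) b0B.
have sA : shift b0 A \subset (A * B)%g.
  apply/subsetP=> x; rewrite inE => xA; rewrite -(subrK b0 x); exact: mem_sumset.
have X1 : X != set0 -> (#|X| <= 1)%N.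
  move=> X0; have D0 : D != set0 by rewrite -card_gt0; move: cD B3; card_lia.
  have sXD : (X * D)%g \subset (A * B)%g by rewrite mulgSS ?subsetDl.
  have cd := cauchy_davenport p_pr X0 D0 (ltAB _ sXD).
  have disj : [disjoint shift b0 A & (X * D)%g].
    apply/pred0P=> z /=; apply/negbTE/negP => /andP[].
    rewrite inE => + /sumsetP[x [y [xX yD ez]]]; rewrite ez => h.
    have : y \in Be x.
      rewrite !inE; move: yD; rewrite !inE => /andP[_ ->] /=.
      by move: h; congr (_ \in A); ring.
    by rewrite B1 // inE; move: yD; rewrite !inE => /andP[/negPf->].
  have sU : shift b0 A :|: (X * D)%g \subset (A * B)%g by rewrite subUset sA.
  move: disj; rewrite -leq_card_setU => /eqP eU.
  move: (subset_leq_card sU) crit cd; rewrite eU card_shift cD.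
  by card_lia.
have [Y0|Y0] := eqVneq Y set0.
  have XA : X = A by rewrite /X Y0 setD0.
  by move: X1; rewrite XA -card_gt0 => /(_ (ltn_trans (ltnSn _) A2)); rewrite leqNgt A2.
have sYB : (Y * B)%g \subset shift b0 A.
  apply/subsetP=> z /sumsetP[x [y [+ yB ->]]]; rewrite !inE => /andP[xA /subsetP/(_ _ yB)].
  by rewrite inE; congr (_ \in A); ring.
have cd := cauchy_davenport p_pr Y0 B0 (ltAB _ (subset_trans sYB sA)).
have X0 : X != set0.
  by rewrite -card_gt0; move: (subset_leq_card sYB) cd cXY B3; rewrite card_shift; card_lia.
by move: (X1 X0) (subset_leq_card sYB) cd cXY B3; rewrite card_shift; card_lia.
Qed.
End Vosper.

Section Extremal.
Variable p : nat.
Hypothesis p_pr : prime p.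

Lemma Fp_natmul (k x : 'F_p) : k != 0 -> exists2 j, (j < p)%N & x = k *+ j.
Proof.
move=> k0; exists (val (x / k)).
  by have := ltn_ord (x / k); rewrite [X in (_ < X)%N](Fp_cast p_pr).
by rewrite -mulr_natr natr_Zp mulrC divfK.
Qed.

Lemma Fp_natmul_eq0 (k : 'F_p) j : k != 0 -> (k *+ j == 0) = (p %| j)%N.
Proof.
by move=> k0; rewrite -mulr_natr mulf_eq0 (negPf k0) /= (dvdn_pcharf (pchar_Fp p_pr)).
Qed.

Lemma Fp_natmul_inj (k : 'F_p) i j : k != 0 -> (i < p)%N -> (j < p)%N ->
  k *+ i = k *+ j -> i = j.
Proof.
move=> k0; wlog ij : i j / (i <= j)%N.
  by move=> H; case/orP: (leq_total i j) => ij ip jp e; [|apply/esym]; apply: H.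
move=> ip jp e; have : k *+ (j - i) == 0 by rewrite mulrnBr // e subrr.
rewrite Fp_natmul_eq0 // => /dvdn_leq h; apply/eqP; rewrite eqn_leq ij leqNgt.
by apply/negP=> lt; have := h _; lia.
Qed.

(* [S] is closed under subtracting [k] except at one point. *)
Lemma one_end_progression (k : 'F_p) (S : {set 'F_p}) : k != 0 ->
    S != set0 -> S != setT -> (#|ends k (~: S)| <= 1)%N ->
  exists s, forall j, (j < p)%N -> (s + k *+ j \in S) = (j < #|S|)%N.
Proof.
move=> k0 S0 ST end1.
have C0 : ~: S != set0 by apply: contra ST => /eqP e; rewrite -(setCK S) e setC0.
have CT : ~: S != setT by apply: contra S0 => /eqP e; rewrite -(setCK S) e setCT.
have /set0Pn[e eE] := ends_neq0 p_pr k0 C0 CT.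
have eE' := eE; move: eE'; rewrite !inE negbK => /andP[eS ekS].
exists (e + k).
have uniq x : x \in S -> x - k \notin S -> x = e + k.
  move=> xS xk; have xE : x - k \in ends k (~: S) by rewrite !inE xk subrK xS.
  by rewrite -(card_le1_eqP end1 _ _ eE xE) subrK.
have down j : (j.+1 < p)%N -> e + k + k *+ j.+1 \in S -> e + k + k *+ j \in S.
  move=> jp jS; apply/negPn/negP => njS; have := uniq _ jS.
  rewrite mulrS (addrC k (k *+ j)) addrA addrK => /(_ njS) h.
  have : k *+ j.+1 == 0.
    by rewrite mulrS -(subr_eq0 _ 0) subr0 -(inj_eq (addrI (e + k))) addr0 addrC -{2}h; apply/eqP; ring.
  by rewrite Fp_natmul_eq0 // => /dvdn_leq; lia.
have down_le i j : (i <= j)%N -> (j < p)%N -> e + k + k *+ j \in S -> e + k + k *+ i \in S.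
  move=> /subnKC <-; elim: (j - i)%N => [|d IH]; first by rewrite addn0.
  by rewrite addnS => lt /(down _ lt); apply: IH; apply: ltnW.
pose f (j : 'I_p) := e + k + k *+ j.
have f_inj : injective f.
  by move=> i j /addrI /(Fp_natmul_inj k0 (ltn_ord i) (ltn_ord j)) /val_inj.
have cS : #|S| = #|[set j | f j \in S]|.
  rewrite -(card_imset _ f_inj); apply: eq_card => x; apply/idP/imsetP.
    move=> xS; have [j jp ej] := Fp_natmul (x - (e + k)) k0.
    have ef : x = f (Ordinal jp) by rewrite /f /= -ej addrC subrK.
    by exists (Ordinal jp) => //; rewrite inE -ef.
  by case=> j; rewrite inE => jS ->.
have card_lt n : (n <= p)%N -> #|[set j : 'I_p | (j < n)%N]| = n.
  move=> np; have wI : injective (widen_ord np).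
    by move=> i j /(congr1 val) /= ij; apply: val_inj.
  have := card_ord n; rewrite -cardsT -(card_imset _ wI).
  move=> {2}<-; apply: eq_card => j; rewrite inE; apply/idP/imsetP.
    by move=> jn; exists (Ordinal jn) => //; apply: val_inj.
  by case=> i _ ->; exact: (ltn_ord i).
move=> j jp; apply/idP/idP => jS.
  rewrite cS -(card_lt j.+1 jp) subset_leq_card //; apply/subsetP=> i; rewrite !inE ltnS => ij.
  exact: down_le jS.
apply: contraLR jS => jS; rewrite -leqNgt cS -[leqRHS](card_lt j (ltnW jp)).
rewrite subset_leq_card //; apply/subsetP=> i; rewrite !inE ltnNge; apply: contraL => ji.
by apply: contra jS; apply: down_le.
Qed.

Lemma sum_free_extremal (m : nat) (S : {set 'F_p}) : p.+1 = (3 * m)%N ->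
    (forall x y, x \in S -> y \in S -> x + y \notin S) -> (m <= #|S|)%N ->
  exists2 k, k != 0 & forall x, x \in S -> exists2 j, (m <= j < 2 * m)%N & x = k *+ j.
Proof.
move=> pm sf mS.
have m0 : (0 < m)%N by case: (m) pm; rewrite ?muln0.
have S0 : S != set0 by rewrite -card_gt0; exact: leq_trans mS.
have disj : (S * S)%g \subset ~: S.
  by apply/subsetP=> z /sumsetP[x [y [xS yS ->]]]; rewrite inE sf.
have nT : (S * S)%g != setT.
  apply: contra S0 => /eqP e; move: disj; rewrite e subTset => /eqP eC.
  by rewrite -(setCK S) eC setCT.
have cd := cauchy_davenport p_pr S0 S0 nT.
have cC : (#|S| + #|~: S| = p)%N by rewrite cardsC card_Fp.
have cS : #|S| = m.
  by move: (subset_leq_card disj) cd cC pm mS; card_lia.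
have eC : (S * S)%g = ~: S.
  by apply/eqP; rewrite eqEcard disj; move: cd cC pm cS; card_lia.
have zS x : x \in S -> x != 0.
  by move=> xS; apply/eqP=> x0; have := sf _ _ xS xS; rewrite x0 addr0 -x0 xS.
have [m2|m1] := ltnP 1 m; last first.
  have /cards1P[s eS] : #|S| == 1%N by rewrite cS eqn_leq m1.
  exists s; first by apply: zS; rewrite eS set11.
  by move=> x; rewrite eS inE => /eqP ->; exists 1%N => //; lia.
have [||||k k0 k1] := @vosper_sumset _ p_pr S S; rewrite ?cS //.
- by rewrite eC; move: cC pm cS; card_lia.
- by rewrite eC; move: cC pm cS m2; card_lia.
rewrite eC in k1.
have ST : S != setT.
  by apply/eqP=> e; move: nT; rewrite e mulGid eqxx.
have [s sP] := one_end_progression k0 S0 ST k1; rewrite cS in sP.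
have [r rp er] := Fp_natmul s k0.
have mp : (m < p)%N by lia.
have inS j : (j < m)%N -> s + k *+ j \in S by move=> jm; rewrite sP // (ltn_trans jm).
have s_in : s \in S by have := inS 0%N m0; rewrite mulr0n addr0.
have mr : (m <= r)%N.
  by have := sf _ _ s_in s_in; rewrite {2}er sP // -leqNgt.
have er' : r = m.
  apply/eqP; rewrite eqn_leq mr andbT leqNgt; apply/negP => ltmr.
  pose i := minn (p - r) m.-1.
  have := sf _ _ (inS i _) (inS (p - r - i)%N _); rewrite /i.
  have i1 : (minn (p - r) m.-1 < m)%N by lia.
  have i2 : (p - r - minn (p - r) m.-1 < m)%N by lia.
  move=> /(_ i1 i2); rewrite addrACA -mulrnDr subnKC ?geq_minl // {2}er -addrA -mulrnDr.
  rewrite subnKC ?(ltnW rp) // (_ : k *+ p = 0) ?addr0 ?s_in //.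
  by apply/eqP; rewrite Fp_natmul_eq0.
exists k => // x xS; have [j jp ej] := Fp_natmul (x - s) k0.
have ex : x = s + k *+ j by rewrite -ej addrC subrK.
have jm : (j < m)%N by rewrite -sP // -ex.
exists (m + j)%N; first by lia.
by rewrite ex er er' mulrnDr.
Qed.
End Extremal.

(** * Density profiles on F_p *)

Lemma reverse_pair_sum (R : realFieldType) (b : nat -> R) (B : R) (k n : nat) :
    (forall x y, (k <= x < n)%N -> (k <= y < n)%N -> (x + y).+1 = (k + n)%N ->
      b x + b y <= B) ->
  2%:R * \sum_(k <= x < n) b x <= (n - k)%:R * B.
Proof.
move=> h; rewrite mulr_natl mulr2n {2}big_nat_rev -big_split /=.
rewrite [X in _ <= X]mulr_natl -sumr_const_nat.
rewrite !big_nat; apply: ler_sum => x /andP[kx xn].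
by apply: h; lia.
Qed.

Lemma dense_numeric (R : realFieldType) (M P T t E : R) : 4 <= M -> P = 3 * M - 1 ->
    0 <= E <= 3 * M - 2 -> 0 <= t -> M - 2^-1 + P^-1 <= T -> T <= t * (P - T) ->
  2 * (P * T) <= (3 * M - E) / 2 * P + E * (3 * M - P * t) -> False.
Proof.
move=> M4 PE /andP[E0 EM] t0 lT lt h.
have P0 : 0 < P by lra.
pose k := P * t; pose u := P * T; pose u0 := P * M - P / 2 + 1.
have u0u : u0 <= u.
  have := ler_wpM2l (ltW P0) lT; rewrite mulrDr mulrBr divff ?gt_eqF // /u0 /u; lra.
have k0 : 0 <= k by rewrite mulr_ge0 // ltW.
have ku : P * u <= k * (P * P - u).
  have -> : k * (P * P - u) = P * P * (t * (P - T)) by rewrite /k /u; ring.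
  by rewrite /u mulrA ler_wpM2l // mulr_ge0 // ltW.
have ku0 : P * u0 <= k * (P * P - u0).
  apply: le_trans (ler_wpM2l (ltW P0) u0u) _; apply: le_trans ku _.
  by rewrite ler_wpM2l // lerD2l lerN2.
have kl : 3 * M ^+ 2 + 2 * M - 4 < (3 * M - 2) * k.
  rewrite ltNge; apply/negP => kl.
  have D0 : 0 < P * P - u0 by rewrite /u0 PE; nra.
  have h1 := ler_wpM2r (ltW D0) kl.
  have h2 : (3 * M - 2) * (P * u0) <= (3 * M - 2) * (k * (P * P - u0)).
    by rewrite ler_wpM2l //; lra.
  have h3 := le_trans h2 (le_trans (eq_ind_r (fun z => z <= _) (lexx _) (mulrA _ _ _)) h1).
  pose d := M - 4; have d0 : 0 <= d by rewrite subr_ge0.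
  have Md : M = d + 4 by rewrite subrK.
  suff : 9 * d ^+ 4 + 93 * d ^+ 3 + 653 / 2 * d ^+ 2 + 841 / 2 * d + 107 <= 0.
    have := exprn_ge0 4 d0; have := exprn_ge0 3 d0; have := exprn_ge0 2 d0; lra.
  rewrite -subr_ge0 in h3; rewrite -oppr_ge0; move: h3; congr (0 <= _).
  by rewrite /u0 PE Md; field.
have h0 : 0 < 4 * u - 3 * M * P.
  suff : 0 < 4 * u0 - 3 * M * P by lra.
  by rewrite /u0 PE; nra.
have h1 : 0 < 2 * u - P - (3 * M - 2) * (3 * M - k).
  suff : 0 <= 2 * u0 - P - (3 * M - 2) * (3 * M) + (3 * M ^+ 2 + 2 * M - 4) by lra.
  by rewrite /u0 PE; nra.
rewrite -/k -/u in h.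
have h2 : 0 <= (3 * M - 2 - E) * (4 * u - 3 * M * P) by apply: mulr_ge0; [rewrite subr_ge0 | exact: ltW].
have h3 : 0 <= E * (2 * (2 * u - P - (3 * M - 2) * (3 * M - k))).
  by apply: mulr_ge0 => //; apply: mulr_ge0 => //; exact: ltW.
have [E1|E1] := ltrP E (3 * M - 2).
  have h4 : 0 < (3 * M - 2 - E) * (4 * u - 3 * M * P).
    by apply: mulr_gt0 => //; rewrite subr_gt0.
  have : 0 < (3 * M - 2) * (4 * u - (3 * M - E) * P - 2 * E * (3 * M - k)).
    have -> : (3 * M - 2) * (4 * u - (3 * M - E) * P - 2 * E * (3 * M - k)) =
      (3 * M - 2 - E) * (4 * u - 3 * M * P) +
      E * (2 * (2 * u - P - (3 * M - 2) * (3 * M - k))) by rewrite PE; ring.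
    by apply: ltr_wpDr.
  by rewrite pmulr_rgt0; lra.
have EE : E = 3 * M - 2 by apply/eqP; rewrite eq_le EM.
by move: h; rewrite EE; lra.
Qed.

Section Ranks.
Variables (R : realFieldType) (p : nat) (a : 'F_p -> R).
Hypothesis p_pr : prime p.
Hypothesis a_ge0 : forall i, 0 <= a i.

Definition ranking : seq 'F_p := sort (fun i j => a j <= a i) (enum 'F_p).
Definition ranked (x : nat) : R := a (nth 0 ranking x).
Let s := ranking.
Let b := ranked.

Lemma size_ranking : size s = p.
Proof. by rewrite size_sort -cardE card_Fp. Qed.

Lemma uniq_ranking : uniq s.
Proof. by rewrite sort_uniq enum_uniq. Qed.

Lemma mem_ranking i : i \in s.
Proof. by rewrite mem_sort mem_enum. Qed.

Lemma ranked_anti x y : (x <= y < p)%N -> b y <= b x.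
Proof.
move=> /andP[xy yp].
have tr : transitive (fun i j => a j <= a i) by move=> j i k ij jk; exact: le_trans jk ij.
have ss : sorted (fun i j => a j <= a i) s.
  by apply: sort_sorted => i j; exact: le_total.
apply: (sorted_leq_nth tr _ 0 ss) => //; rewrite inE size_ranking //.
exact: leq_ltn_trans yp.
Qed.

Lemma sum_ranked : \sum_i a i = \sum_(0 <= x < p) b x.
Proof.
rewrite -[in RHS]size_ranking /b /ranked -(big_nth 0 xpredT a).
have e : perm_eq s (enum 'F_p) by rewrite perm_sort.
by rewrite [RHS](perm_big _ e) big_enum.
Qed.

Definition top (x : nat) : {set 'F_p} := [set i in take x.+1 s].

Lemma card_top x : (x < p)%N -> #|top x| = x.+1.
Proof.
move=> xp; rewrite cardsE (card_uniqP _) ?take_uniq ?uniq_ranking //.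
by rewrite size_takel // size_ranking.
Qed.

Lemma top_ge x i : (x < p)%N -> i \in top x -> b x <= a i.
Proof.
move=> xp; rewrite inE => /(nthP 0)[k]; rewrite size_takel ?size_ranking // => kx <-.
by rewrite nth_take //; apply: ranked_anti; rewrite -ltnS kx.
Qed.

Lemma ranked_triple x y z : (x < p)%N -> (y < p)%N -> (z < p)%N ->
  (p <= (x + y + z).+1)%N ->
  exists i j, [/\ b x <= a i, b y <= a j & b z <= a (i + j)].
Proof.
move=> xp yp zp le.
have n0 u : (u < p)%N -> top u != set0 by move=> up; rewrite -card_gt0 card_top.
have [||||i [j [ix jy kz]]] := cauchy_davenport_triple p_pr (X := top x) (Y := top y) (Z := top z);
  rewrite ?n0 ?card_top //; first by lia.
by exists i, j; rewrite !top_ge.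
Qed.

Definition nb_pos := #|[set i | 0 < a i]|.
Let F := nb_pos.

Lemma ranked_gt0 x : (x < F)%N -> 0 < b x.
Proof.
move=> xF; rewrite ltNge; apply/negP => bx.
have xp : (x < p)%N.
  by apply: leq_trans xF _; rewrite -[X in (_ <= X)%N](card_Fp p_pr) max_card.
suff : (F <= x)%N by rewrite leqNgt xF.
rewrite /F /nb_pos; have : [set i | 0 < a i] \subset [set i in take x s].
  apply/subsetP=> i; rewrite !inE => ai.
  have /(nthP 0)[k] := mem_ranking i; rewrite size_ranking => kp ei.
  have [kx|xk] := ltnP k x; last first.
    have := ranked_anti (x := x) (y := k); rewrite xk kp => /(_ isT).
    rewrite /b /ranked ei => /(lt_le_trans ai) h.
    by have := lt_le_trans h bx; rewrite ltxx.
  by rewrite -ei -(nth_take 0 kx) mem_nth // size_takel // size_ranking ltnW.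
move=> /subset_leq_card le; apply: leq_trans le _; rewrite cardsE.
apply: leq_trans (card_size _) _.
by rewrite size_takel // size_ranking ltnW.
Qed.

Lemma ranked_eq0 x : (F <= x < p)%N -> b x = 0.
Proof.
case/andP=> Fx xp; apply/eqP; rewrite eq_le a_ge0 andbT leNgt; apply/negP => bx.
suff : (x < F)%N by rewrite ltnNge Fx.
rewrite -(card_top xp) subset_leq_card //; apply/subsetP=> i /(top_ge xp) h.
by rewrite inE (lt_le_trans bx).
Qed.

Lemma leq_nb_pos : (F <= p)%N.
Proof. by rewrite -[X in (_ <= X)%N](card_Fp p_pr) max_card. Qed.


Section Core.
Variable m : nat.
Hypothesis pm : p.+1 = (3 * m)%N.
Let M : R := m%:R.
Let P : R := p%:R.
Hypothesis a_le1 : forall i, a i <= 1.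
Hypothesis a_triple : forall i j, 0 < a i -> 0 < a j -> 0 < a (i + j) ->
  P * (a i + a j + a (i + j)) <= 3 * M.
Hypothesis a_pigeon : forall i j, 1 < a i + a j -> a (i + j) = 0.
Hypothesis a_half : forall i, 2^-1 < a i -> a 0 = 0.
Let T := \sum_i a i.
Hypothesis T_large : M - 2^-1 + P^-1 <= T.
Variables (i0 : 'F_p).
Hypothesis i0_max : forall i, a i <= a i0.
Hypothesis i0_large : T <= a i0 * (P - T).
Let t := a i0.

Let PE : P = 3 * M - 1.
Proof. by rewrite /P /M -natrM -pm -natr1 addrK. Qed.

Let P_ge2 : 2 <= P.
Proof. by rewrite ler_nat prime_gt1. Qed.

Lemma few_pos_no_triple i j : (F <= m)%N ->
  0 < a i -> 0 < a j -> 0 < a (i + j) -> False.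
Proof.
move=> Fm ai aj aij.
have [k ak lek] : exists2 k, 0 < a k & P * a k <= M.
  have := a_triple ai aj aij => h.
  have [|h1] := lerP (P * a i) M; first by exists i.
  have [|h2] := lerP (P * a j) M; first by exists j.
  exists (i + j) => //; lra.
have : T <= a k + (F.-1)%:R.
  rewrite /T (bigD1 k) //= lerD2l.
  rewrite (bigID (fun l => 0 < a l)) /= [X in _ + X]big1 ?addr0; last first.
    by move=> l /andP[_]; rewrite -leNgt => l0; apply/eqP; rewrite eq_le l0 a_ge0.
  apply: le_trans (ler_sum _ (fun l _ => a_le1 l)) _.
  rewrite sumr_const ler_nat /F /nb_pos (cardsD1 k) inE ak /= subset_leq_card //.
  by apply/subsetP=> l; rewrite !inE.
have : (F.-1)%:R <= M - 1 :> R.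
  rewrite lerBrDr natr1 ler_nat; have : (0 < F)%N by apply/card_gt0P; exists k; rewrite inE.
  by lia.
have Pi : P * P^-1 = 1 by rewrite divff // pnatr_eq0 -lt0n prime_gt0.
have M1 : 1 <= M by rewrite ler1n; lia.
move: T_large P_ge2 PE; nra.
Qed.

Let b0 : b 0 = t.
Proof.
apply/eqP; rewrite eq_le i0_max /=.
have := mem_ranking i0 => /(nthP 0)[k]; rewrite size_ranking => kp ek.
have -> : t = b k by rewrite /b /ranked ek.
by apply: ranked_anti.
Qed.

Let L := (3 * m - F)%N.

(* Two slices of total density above 1 and any slice met by the support
   contain a triple, so the least positive value is used as third rank. *)
Lemma sum_top_ranked : (0 < F)%N -> 2 * \sum_(0 <= x < L) b x <= L%:R.
Proof.
move=> F0; rewrite -[X in _ <= X]mulr1 -{2}(subn0 L).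
apply: reverse_pair_sum => x y /andP[_ xL] /andP[_ yL] xy.
have Fp := leq_nb_pos.
rewrite leNgt; apply/negP=> lt1.
have [|||| i [j [ix jy]]] := ranked_triple (x := x) (y := y) (z := F.-1); try by lia.
apply/negP; rewrite -ltNge a_pigeon; last by apply: lt_le_trans lt1 _; exact: lerD.
by apply: ranked_gt0; lia.
Qed.

(* Here the third slice is the largest one. *)
Lemma sum_bottom_ranked : (0 < F)%N ->
  2 * (P * \sum_(L <= x < F) b x) <= (F - L)%:R * (3 * M - P * t).
Proof.
move=> F0; rewrite mulr_sumr.
apply: (reverse_pair_sum (b := fun x => P * b x)) => x y /andP[Lx xF] /andP[Ly yF] xy.
have Fp := leq_nb_pos.
have [|||| i [j [ix jy ij]]] := ranked_triple (x := 0%N) (y := x) (z := y); try by lia.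
have := a_triple (i := i) (j := j).
have b0p : 0 < b 0 by exact: ranked_gt0.
rewrite (lt_le_trans b0p ix) (lt_le_trans (ranked_gt0 xF) jy).
rewrite (lt_le_trans (ranked_gt0 yF) ij) => /(_ isT isT isT).
move: ix; rewrite b0 => ix.
have : P * (t + b x + b y) <= P * (a i + a j + a (i + j)).
  apply: ler_wpM2l; first by move: P_ge2; lra.
  by apply: lerD ij; exact: lerD.
lra.
Qed.

Lemma sum_ranked_split : (L <= F)%N ->
  T = \sum_(0 <= x < L) b x + \sum_(L <= x < F) b x.
Proof.
move=> LF; rewrite /T sum_ranked (big_cat_nat (n := F)) ?leq_nb_pos //=.
rewrite (big_cat_nat (n := L)) //= [X in _ + X]big_nat [X in _ + X]big1 ?addr0 // => x.
exact: ranked_eq0.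
Qed.

Lemma support_no_triple i j : 0 < a i -> 0 < a j -> 0 < a (i + j) -> False.
Proof.
move=> ai aj aij.
have [Fm|mF] := leqP F m; first exact: few_pos_no_triple ai aj aij.
have F0 : (0 < F)%N by apply: leq_trans mF.
have Fp := leq_nb_pos.
have m0 : (0 < m)%N by move: p_pr pm; case: (m) => //; rewrite muln0.
have mF' : M + 1 <= F%:R by rewrite natr1 ler_nat.
have LE : L%:R = 3 * M - F%:R :> R by rewrite /L natrB ?natrM //; apply: leq_trans Fp _; rewrite -pm.
have EP := PE; have P2 := P_ge2.
have P0 : 0 < P by lra.
have Pi : 0 < P^-1 by rewrite invr_gt0.
have [FL|LF] := leqP F L.
  have : T <= \sum_(0 <= x < L) b x.
    rewrite /T sum_ranked (big_cat_nat (n := F)) ?leq_nb_pos //=.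
    rewrite [X in _ + X]big_nat [X in _ + X]big1 ?addr0; last by move=> x; exact: ranked_eq0.
    rewrite [leRHS](big_cat_nat (n := F)) //= lerDl.
    by apply: sumr_ge0 => x _; exact: a_ge0.
  by move: T_large (sum_top_ranked F0); rewrite LE; lra.
have t0 : 0 <= t by exact: a_ge0.
have := sum_ranked_split (ltnW LF) => TE.
have h1 := sum_top_ranked F0; have h2 := sum_bottom_ranked F0.
have FLE : (F - L)%:R = 2 * F%:R - 3 * M :> R by rewrite natrB ?(ltnW LF) // LE; lra.
rewrite FLE in h2; rewrite LE in h1.
have h : 2 * (P * T) <= (3 * M - F%:R) * P + (2 * F%:R - 3 * M) * (3 * M - P * t).
  rewrite TE mulrDr mulrDr lerD // mulrCA mulrC.
  by rewrite ler_wpM2r // ltW.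
have FP : F%:R <= P by rewrite ler_nat.
have LF' : 0 <= 2 * F%:R - 3 * M by rewrite -FLE.
have [m4|m4] := leqP 4 m.
  apply: (@dense_numeric _ M P T t (2 * F%:R - 3 * M)) => //.
  - by rewrite /M ler_nat.
  - by rewrite LF'; lra.
  - by move: h; congr (_ <= _ * _ + _); lra.
have t_half : 2^-1 < t -> (F < p)%N.
  move=> /a_half a00; rewrite -(card_Fp p_pr) -cardsT; apply: proper_card.
  rewrite properT; apply/eqP=> /setP/(_ 0); rewrite !inE a00 ltxx //.
have TP : T <= P.
  apply: le_trans (ler_sum _ (fun l _ => a_le1 l)) _.
  by rewrite sumr_const card_Fp.
have : [|| m == 1, m == 2 | m == 3]%N by case: (m) m0 m4 => [|[|[|[|]]]].
case/or3P=> /eqP em.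
- have M1 : M = 1 by rewrite /M em.
  have PE2 : P = 2 by lra.
  have : (F < p)%N by apply: t_half; move: T_large i0_large; rewrite M1 PE2 -/t -/T; nra.
  by move: pm mF; rewrite em; generalize F; clear; lia.
- have M2 : M = 2 by rewrite /M em.
  have P5 : P = 5 by lra.
  have tl : 17 / 33 <= t.
    move: T_large i0_large; rewrite M2 P5 -/t -/T => h3 h4.
    have : 17 / 10 <= T by lra.
    by nra.
  have Fp4 : (F < p)%N by apply: t_half; lra.
  have F4 : F = 4 by move: Fp4 pm mF LF; rewrite /L em; generalize F; clear; lia.
  by move: h T_large; rewrite M2 P5 F4; lra.
- by move: p_pr; have -> : p = 8 by move: pm; rewrite em; clear; lia.
Qed.

End Core.
End Ranks.

(** * Hyperplane slices *)

Section Functionals.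
Variables (p n : nat).
Hypothesis p_pr : prime p.
Notation V := 'rV['F_p]_n.
Implicit Types (u v x y z : V) (A : {set V}).

Definition dot u x : 'F_p := (x *m u^T) 0 0.

Lemma dotC u x : dot u x = dot x u.
Proof. by rewrite /dot -[in RHS](trmxK (u *m x^T)) trmx_mul trmxK [RHS]mxE. Qed.

Lemma dotD u x y : dot u (x + y) = dot u x + dot u y.
Proof. by rewrite /dot mulmxDl mxE. Qed.

Lemma dotN u x : dot u (- x) = - dot u x.
Proof. by rewrite /dot mulNmx mxE. Qed.

Lemma dotB u x y : dot u (x - y) = dot u x - dot u y.
Proof. by rewrite dotD dotN. Qed.

Lemma dot0 u : dot u 0 = 0.
Proof. by rewrite /dot mul0mx mxE. Qed.

Lemma dotMn u x j : dot u (x *+ j) = dot u x *+ j.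
Proof. by elim: j => [|j IH]; rewrite ?mulr0n ?dot0 // !mulrS dotD IH. Qed.

Lemma dotZ u c x : dot u (c *: x) = c * dot u x.
Proof. by rewrite /dot -scalemxAl mxE. Qed.

Lemma dot_surj u c : u != 0 -> exists x, dot u x = c.
Proof.
case/rV0Pn=> j uj; exists ((c / u 0 j) *: delta_mx 0 j).
by rewrite dotZ /dot -rowE mxE mxE divfK.
Qed.

Definition fiber u c : {set V} := [set x | dot u x == c].

Lemma card_fiber u c : u != 0 -> #|fiber u c| = #|fiber u 0|.
Proof.
move=> u0; have [w wc] := dot_surj c u0.
rewrite -(card_imset (fiber u 0) (addIr w)); apply: eq_card => x.
rewrite inE; apply/idP/imsetP => [/eqP xc|[y + ->]].
  by exists (x - w); rewrite ?subrK // inE dotB wc xc subrr.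
by rewrite inE dotD wc => /eqP ->; rewrite add0r.
Qed.

Lemma card_fiber_mul u c : u != 0 -> (p * #|fiber u c|)%N = (p ^ n)%N.
Proof.
move=> u0; have := card_mx 'F_p 1 n; rewrite card_Fp // mul1n => <-.
rewrite -[RHS]sum1_card [RHS](partition_big (dot u) xpredT) //=.
rewrite [RHS](eq_bigr (fun _ => #|fiber u c|)) ?sum_nat_const ?card_Fp // => d _.
rewrite (card_fiber c u0) -(card_fiber d u0) -sum1_card.
by apply: eq_bigl => x; rewrite inE.
Qed.

Lemma kernel_group_set u : group_set (fiber u 0).
Proof.
apply/group_setP; split; first by rewrite inE dot0.
by move=> x y; rewrite !inE => /eqP xK /eqP yK; rewrite dotD xK yK addr0.
Qed.
Definition kernel u := Group (kernel_group_set u).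

Lemma kernel_pgroup u : u != 0 -> (p.-group (kernel u))%g.
Proof.
move=> u0; apply: (@pnat_dvd _ (p ^ n)); last by rewrite pnatX pnat_id.
by rewrite -(card_fiber_mul 0 u0) dvdn_mull.
Qed.

Lemma fiber_coset u x : fiber u (dot u x) = (x *: kernel u)%g.
Proof.
apply/setP=> y; rewrite mem_lcoset !inE dotD dotN addrC subr_eq0.
by rewrite eq_sym.
Qed.

Definition slice A u c : {set V} := A :&: fiber u c.

Lemma in_slice A u c x : (x \in slice A u c) = (x \in A) && (dot u x == c).
Proof. by rewrite !inE. Qed.

Lemma slice_sub_coset A u c x : x \in slice A u c -> slice A u c \subset (x *: kernel u)%g.
Proof.
by rewrite in_slice -fiber_coset => /andP[_ /eqP ->]; exact: subsetIr.
Qed.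

Section Averaging.
Variable R : realFieldType.
Implicit Types (f : 'F_p -> R).

Lemma sum_slice A u f : \sum_(x in A) f (dot u x) = \sum_c #|slice A u c|%:R * f c.
Proof.
rewrite (partition_big (dot u) xpredT) //=; apply: eq_bigr => c _.
rewrite mulr_natl -sumr_const; apply: eq_big => x; first by rewrite in_slice.
by case/andP=> _ /eqP ->.
Qed.

(* Cauchy-Schwarz, [2 f i f (k - i) <= f i ^ 2 + f (k - i) ^ 2], applied to
   the convolution of [f] with itself. *)
Lemma triple_sum_lb (f : 'F_p -> R) (M : R) : (forall i, f i <= M) ->
  M * (\sum_i f i) ^+ 2 - (p%:R * M - \sum_i f i) * (\sum_i f i ^+ 2)
    <= \sum_i \sum_j f i * (f j * f (i + j)).
Proof.
move=> fM; set N := \sum_i f i; set Q := \sum_i f i ^+ 2.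
pose g k := \sum_i f i * f (k - i).
have E : \sum_i \sum_j f i * (f j * f (i + j)) = \sum_k g k * f k.
  rewrite exchange_big /= [in RHS](eq_bigr (fun k => \sum_i f i * f (k - i) * f k)); last first.
    by move=> k _; rewrite mulr_suml.
  rewrite [RHS]exchange_big [LHS]exchange_big /=; apply: eq_bigr => i _.
  rewrite [RHS](reindex_inj (addrI i)) /=; apply: eq_bigr => j _.
  by rewrite (addrC i) addrK mulrA.
have Eg : \sum_k g k = N ^+ 2.
  rewrite /g exchange_big /= expr2 /N mulr_suml; apply: eq_bigr => i _.
  rewrite -mulr_sumr; congr (_ * _); rewrite (reindex_inj (addIr i)) /=.
  by apply: eq_bigr => j _; rewrite addrK.
have gQ k : g k <= Q.
  have e : Q = \sum_i (f i ^+ 2 + f (k - i) ^+ 2) / 2.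
    rewrite -mulr_suml big_split /= [X in _ + X](_ : _ = Q).
      by rewrite -/Q; lra.
    have kI : injective (fun i : 'F_p => k - i) by move=> i j /addrI /oppr_inj.
    by rewrite [RHS](reindex_inj kI).
  rewrite e; apply: ler_sum => i _; have := sqr_ge0 (f i - f (k - i)); lra.
rewrite E; have -> : \sum_k g k * f k = M * N ^+ 2 - \sum_k g k * (M - f k).
  rewrite -Eg mulr_sumr -sumrB; apply: eq_bigr => k _; ring.
rewrite lerD2l lerN2; have -> : p%:R * M - N = \sum_k (M - f k).
  by rewrite sumrB sumr_const card_Fp // mulr_natl.
rewrite mulr_suml; apply: ler_sum => k _.
by rewrite mulrC ler_wpM2l // subr_ge0.
Qed.

Lemma sum_functionals v (q : nat) : (p * q = p ^ n)%N ->
  \sum_(u : V | u != 0) (dot u v == 0)%:R = (if v == 0 then p%:R * q%:R else q%:R) - 1 :> R.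
Proof.
move=> pq; have all : \sum_(u : V) (dot u v == 0)%:R = (if v == 0 then p%:R * q%:R else q%:R) :> R.
  rewrite -natr_sum -natrM -(fun_if (fun k : nat => k%:R)); congr _%:R.
  have [->|v0] := eqVneq v 0.
    rewrite (eq_bigr (fun _ => 1%N)); last by move=> u _; rewrite dot0 eqxx.
    by rewrite sum1_card card_mx card_Fp // mul1n pq.
  rewrite -big_mkcond /= sum1_card.
  apply/eqP; rewrite -(eqn_pmul2l (prime_gt0 p_pr)) pq -(card_fiber_mul 0 v0).
  apply/eqP; congr (_ * _)%N; apply: eq_card => u; rewrite inE dotC //.
rewrite (bigD1 0) //= in all.
by rewrite -all dotC dot0 eqxx [RHS]addrC addKr.
Qed.

Lemma sum_free_dense_slice A (q M : nat) : (p * q = p ^ n)%N -> sum_free A ->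
    (forall u c, u != 0 -> (#|slice A u c| <= M)%N) ->
  #|A|%:R * q%:R <= M%:R * (p%:R * q%:R - #|A|%:R) :> R.
Proof.
move=> pq sf AM; set N : R := #|A|%:R.
have [A0|A0] := eqVneq #|A| 0%N.
  by rewrite /N A0 mul0r subr0 !mulr_ge0.
have N0 : 0 < N by rewrite ltr0n lt0n.
have lb u : u != 0 -> M%:R * N ^+ 2 - (p%:R * M%:R - N) *
     (\sum_(x in A) \sum_(y in A) (dot u (x - y) == 0)%:R)
   <= \sum_(x in A) \sum_(y in A) \sum_(z in A) (dot u (x + y - z) == 0)%:R.
  move=> u0; pose f c : R := #|slice A u c|%:R.
  have fE c : f c = \sum_(z in A) (c - dot u z == 0)%:R.
    rewrite (sum_slice A u (fun d => (c - d == 0)%:R)) (bigD1 c) //= subrr eqxx mulr1.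
    by rewrite big1 ?addr0 // => d dc; rewrite subr_eq0 eq_sym (negPf dc) mulr0.
  have := @triple_sum_lb f M%:R _; rewrite -(_ : N = \sum_i f i); last first.
    rewrite /N -sumr_const (eq_bigr (fun x => (fun _ => 1) (dot u x))) //.
    by rewrite (sum_slice A u (fun=> 1)); apply: eq_bigr => c _; rewrite mulr1.
  rewrite -(_ : \sum_(x in A) \sum_(y in A) (dot u (x - y) == 0)%:R = \sum_i f i ^+ 2); last first.
    rewrite (eq_bigr (fun x => f (dot u x))) ?sum_slice // => x _.
    by rewrite fE; apply: eq_bigr => y _; rewrite dotB.
  rewrite -(_ : \sum_(x in A) \sum_(y in A) \sum_(z in A) (dot u (x + y - z) == 0)%:R =
     \sum_i \sum_j f i * (f j * f (i + j))); last first.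
    transitivity (\sum_(x in A) \sum_j f j * f (dot u x + j)); last first.
      rewrite (sum_slice A u (fun i => \sum_j f j * f (i + j))).
      by apply: eq_bigr => i _; rewrite mulr_sumr.
    apply: eq_bigr => x _; rewrite -(sum_slice A u (fun j => f (dot u x + j))).
    by apply: eq_bigr => y _; rewrite fE; apply: eq_bigr => z _; rewrite dotB dotD.
  by apply=> i; rewrite ler_nat AM.
have sumN (F : V -> R) (C : R) : (forall x, x \in A -> F x = C) -> \sum_(x in A) F x = N * C.
  by move=> FC; rewrite (eq_bigr (fun=> C)) // sumr_const -[LHS]mulr_natl.
have {lb} := ler_sum (index_enum V) lb; rewrite sumrB sumr_const -mulr_sumr.
rewrite (_ : \sum_(u : V | u != 0) \sum_(x in A) \sum_(y in A) (dot u (x - y) == 0)%:R =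
   N * ((N - 1) * (q%:R - 1) + (p%:R * q%:R - 1))); last first.
  rewrite exchange_big /=; apply: (sumN) => x xA.
  rewrite exchange_big /= (bigD1 x) //= (sum_functionals _ pq) subrr eqxx addrC; congr (_ + _).
  rewrite (eq_bigr (fun _ => q%:R - 1)); last first.
    by move=> y /andP[_ yx]; rewrite (sum_functionals _ pq) subr_eq0 eq_sym (negPf yx).
  rewrite sumr_const -[LHS]mulr_natl; congr (_ * _); rewrite /N [in RHS](cardD1 x) xA.
  rewrite natrD addrC addKr; congr _%:R; apply: eq_card => y.
  by rewrite !inE andbC.
rewrite (_ : \sum_(u : V | u != 0) \sum_(x in A) \sum_(y in A) \sum_(z in A)
     (dot u (x + y - z) == 0)%:R = N * (N * (N * (q%:R - 1)))); last first.
  rewrite exchange_big /=; apply: (sumN) => x xA.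
  rewrite exchange_big /=; apply: (sumN) => y yA.
  rewrite exchange_big /=; apply: (sumN) => z zA.
  rewrite (sum_functionals _ pq) subr_eq0; case: eqP => // e; case: sf.
  by exists x, y, z.
rewrite -[_ *+ _]mulr_natl (_ : #|_|%:R = p%:R * q%:R - 1 :> R); last first.
  have := cardC1 (0 : V); rewrite card_mx card_Fp // mul1n -pq => e.
  rewrite -natrM -(@natrB _ _ 1) ?subn1; last first.
    by rewrite pq expn_gt0 prime_gt0.
  by rewrite -e; congr _%:R; apply: eq_card => u; rewrite !inE.
set P : R := p%:R; set q' : R := q%:R; set M' : R := M%:R => le.
have P1 : 0 < P - 1 by rewrite subr_gt0 ltr1n prime_gt1.
rewrite -subr_ge0 in le; rewrite -subr_ge0 -(pmulr_rge0 _ (mulr_gt0 N0 P1)).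
by apply: (le_trans le); rewrite le_eqVlt; apply/orP; left; apply/eqP; ring.
Qed.
End Averaging.
End Functionals.

Definition hyperplane (p n : nat) (u : 'rV['F_p]_n) : {vspace 'rV['F_p]_n} :=
  lker (linfun (mulmxr u^T : 'rV_n -> 'rV_1)).

Lemma mem_hyperplane (p n : nat) (u x : 'rV['F_p]_n) :
  (x \in hyperplane u) = (dot u x == 0).
Proof.
rewrite memv_ker lfunE /= /dot; apply/eqP/eqP => [->|e]; first by rewrite mxE.
by rewrite (mx11_scalar (x *m u^T)) e raddf0.
Qed.

Lemma dim_hyperplane (p n : nat) (u : 'rV['F_p]_n) : prime p -> u != 0 ->
  (\dim (hyperplane u)).+1 = n.
Proof.
move=> p_pr u0; suff : (p ^ (\dim (hyperplane u)).+1 = p ^ n)%N.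
  by move/(expnI (prime_gt1 p_pr)).
rewrite -(card_fiber_mul p_pr 0 u0) expnS; congr (_ * _)%N.
have := card_vspace (hyperplane u); rewrite card_Fp // => <-.
by apply: eq_card => x; rewrite mem_hyperplane inE.
Qed.

Section Slices.
Variables (p n : nat).
Hypothesis p_pr : prime p.
Notation V := 'rV['F_p]_n.
Variables (A : {set V}) (u : V).
Hypothesis sf : sum_free A.
Hypothesis u0 : u != 0.

Let abV : abelian [set: V]. Proof. exact: FinRing.zmod_abelian. Qed.

Lemma slice_mem c x : x \in slice A u c -> x \in A /\ dot u x = c.
Proof. by rewrite in_slice => /andP[? /eqP]. Qed.

Lemma slice_triple i j : slice A u i != set0 -> slice A u j != set0 ->
    slice A u (i + j) != set0 ->
  (p * (#|slice A u i| + #|slice A u j| + #|slice A u (i + j)%R|)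
     <= p.+1 * #|kernel u|)%N.
Proof.
move=> i0 j0 ij0; have [x xi] := set0Pn _ i0; have [y yj] := set0Pn _ j0.
apply: (@coset_triple_card _ p (kernel u) abV x y) => //.
- exact: kernel_pgroup.
- exact: slice_sub_coset xi.
- exact: slice_sub_coset yj.
- rewrite -fiber_coset FinRing.zmodMgE dotD.
  by have [_ ->] := slice_mem xi; have [_ ->] := slice_mem yj; exact: subsetIr.
move=> a b /slice_mem[aA _] /slice_mem[bA _]; apply/negP => /slice_mem[abA _].
by apply: sf; exists a, b, (a + b).
Qed.

Lemma slice_pigeonhole i j : slice A u i != set0 -> slice A u j != set0 ->
    (#|kernel u| < #|slice A u i| + #|slice A u j|)%N ->
  slice A u (i + j) = set0.
Proof.
move=> i0 j0 lt; have [x xi] := set0Pn _ i0; have [y yj] := set0Pn _ j0.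
apply/eqP/negPn/negP => /set0Pn[z zij].
have zK : z \in ((x * y) *: kernel u)%g.
  rewrite -fiber_coset FinRing.zmodMgE dotD inE.
  have [_ ->] := slice_mem xi; have [_ ->] := slice_mem yj.
  by have [_ ->] := slice_mem zij.
have [a [b [aX bY e]]] :=
  coset_pigeonhole abV (slice_sub_coset xi) (slice_sub_coset yj) zK lt.
have [aA _] := slice_mem aX; have [bA _] := slice_mem bY.
have [zA _] := slice_mem zij.
by apply: sf; exists a, b, z.
Qed.

Lemma slice_half i : (#|kernel u| < #|slice A u i| + #|slice A u i|)%N ->
  slice A u 0%R = set0.
Proof.
move=> lt; have i0 : slice A u i != set0.
  by rewrite -card_gt0; move: lt; card_lia.
have [x xi] := set0Pn _ i0.
apply/eqP/negPn/negP => /set0Pn[z z0].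
pose Y := [set y | - y \in slice A u i].
have cY : #|Y| = #|slice A u i|.
  by rewrite -(card_preimset (slice A u i) (f := fun y => - y)) //; exact: oppr_inj.
have sY : Y \subset ((- x)%R *: kernel u)%g.
  apply/subsetP=> y; rewrite inE => /slice_mem[_ e].
  rewrite -fiber_coset inE dotN; have [_ ->] := slice_mem xi.
  by rewrite -e dotN opprK.
have zK : z \in ((x * (- x)%R) *: kernel u)%g.
  rewrite -fiber_coset FinRing.zmodMgE subrr dot0 inE.
  by have [_ ->] := slice_mem z0.
rewrite -[X in (_ + X)%N]cY in lt.
have [a [b [aX bY e]]] := coset_pigeonhole abV (slice_sub_coset xi) sY zK lt.
move: bY; rewrite inE => bY.
have [aA _] := slice_mem aX; have [bA _] := slice_mem bY.
have [zA _] := slice_mem z0.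
by apply: sf; exists z, (- b), a; split=> //; rewrite -e FinRing.zmodMgE addrK.
Qed.

Lemma sum_card_slice : (\sum_i #|slice A u i| = #|A|)%N.
Proof.
rewrite -[RHS]sum1_card (partition_big (dot u) xpredT) //=.
by apply: eq_bigr => i _; rewrite -sum1_card; apply: eq_bigl => x; rewrite in_slice.
Qed.

Lemma slice_le i : (#|slice A u i| <= #|kernel u|)%N.
Proof. by rewrite -(card_fiber i u0) subset_leq_card ?subsetIr. Qed.

End Slices.

Unset Implicit Arguments.
Theorem theorem1p5 (p n : nat) (p_prime : prime p) (p_mod3 : p = 2 %[mod 3])
  (A : {set 'rV['F_p]_n}) (A_sum_free : sum_free A)
  (A_large : ((m_ p)%:R - 1 / 2%:R + 1 / p%:R) * p%:R ^ (n%:Z - 1)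
               <= #|A|%:R :> rat) :
  normal_set A.
Proof.
set m := m_ p in A_large *.
have pm : p.+1 = (3 * m)%N by rewrite /m /m_; lia.
have p0 : 0 < p%:R :> rat by rewrite ltr0n prime_gt0.
have m1 : 1 <= m%:R :> rat by rewrite ler1n; lia.
have coef0 : 0 < m%:R - 1 / 2%:R + 1 / p%:R :> rat.
  have : 0 < 1 / p%:R :> rat by rewrite divr_gt0.
  lra.
case: n => [|n] in A A_sum_free A_large *.
  have : 0 < #|A|%:R :> rat.
    by apply: lt_le_trans A_large; rewrite mulr_gt0 // exprz_gt0.
  rewrite ltr0n => /card_gt0P[x xA]; case: A_sum_free.
  by exists x, x, x; rewrite xA [x + x]thinmx0 [x]thinmx0.
have {}A_large : (m%:R - 2^-1 + p%:R^-1) * (p ^ n)%:R <= #|A|%:R :> rat.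
  move: A_large; rewrite (_ : n.+1%:Z - 1 = n%:Z); last by rewrite -addn1 PoszD addrK.
  by rewrite -exprnP natrX !mul1r.
set q := (p ^ n)%N in A_large.
have pq : (p * q = p ^ n.+1)%N by rewrite expnS.
have q0 : 0 < q%:R :> rat by rewrite ltr0n expn_gt0 prime_gt0.
pose e0 : 'rV['F_p]_n.+1 := delta_mx 0 0.
have e00 : e0 != 0.
  by apply/eqP=> /matrixP/(_ 0 0); rewrite !mxE !eqxx => /eqP; rewrite oner_eq0.
pose P (ui : 'rV['F_p]_n.+1 * 'F_p) := ui.1 != 0.
have [[u i0] /= u0 umax] := @arg_maxnP _ (e0, 0) P (fun ui => #|slice A ui.1 ui.2|) e00.
have fq c : #|fiber u c| = q.
  have := card_fiber_mul p_prime c u0.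
  by rewrite expnS => /eqP; rewrite eqn_pmul2l ?prime_gt0 // => /eqP.
have kq : #|kernel u| = q by exact: (fq 0).
have avg := @sum_free_dense_slice p n.+1 p_prime rat A q #|slice A u i0| pq A_sum_free
  (fun v c v0 => umax (v, c) v0).
pose a i : rat := #|slice A u i|%:R / q%:R.
have a_gt0 i : (0 < a i) = (slice A u i != set0).
  by rewrite pmulr_lgt0 ?invr_gt0 // ltr0n card_gt0.
have sum_a : \sum_i a i = #|A|%:R / q%:R.
  by rewrite -mulr_suml -natr_sum sum_card_slice.
have a_le1 i : a i <= 1.
  by rewrite ler_pdivrMr // mul1r ler_nat -kq slice_le.
have no_triple i j : 0 < a i -> 0 < a j -> 0 < a (i + j) -> False.
  apply: (@support_no_triple rat p a p_prime _ m pm _ _ _ _ _ i0) => {i j}.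
  - by move=> i; rewrite divr_ge0.
  - exact: a_le1.
  - move=> i j; rewrite !a_gt0 => i1 j1 ij1.
    have := slice_triple p_prime A_sum_free u0 i1 j1 ij1.
    rewrite kq pm -(ler_nat rat) !natrM !natrD => h.
    by rewrite -!mulrDl mulrA ler_pdivrMr.
  - move=> i j lt1; apply/eqP; rewrite mulf_eq0 pnatr_eq0 cards_eq0.
    have gt0 k l : 1 < a k + a l -> slice A u k != set0.
      by move=> kl; rewrite -a_gt0; have := a_le1 l; lra.
    have i1 := gt0 _ _ lt1; have j1 : slice A u j != set0 by apply: (gt0 j i); rewrite addrC.
    rewrite (slice_pigeonhole A_sum_free i1 j1) ?eqxx //.
    by move: lt1; rewrite -mulrDl ltr_pdivlMr // mul1r -natrD ltr_nat kq.
  - move=> i lt; rewrite /a (slice_half A_sum_free (i := i)) ?cards0 ?mul0r //.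
    move: lt; rewrite ltr_pdivlMr // kq -(ltr_nat rat) natrD; lra.
  - by rewrite sum_a ler_pdivlMr.
  - by move=> i; rewrite ler_pM2r ?invr_gt0 // ler_nat (umax (u, i)).
  - rewrite sum_a /a mulrAC ler_pM2r ?invr_gt0 // -(ler_pM2r q0).
    by rewrite -mulrA mulrBl divfK ?gt_eqF.
pose S := [set i | 0 < a i].
have S_sum_free i j : i \in S -> j \in S -> i + j \notin S.
  by rewrite !inE => ai aj; apply/negP => aij; apply: no_triple ai aj aij.
have mS : (m <= #|S|)%N.
  have : \sum_i a i <= #|S|%:R.
    rewrite (bigID (mem S)) /= [X in _ + X]big1 ?addr0; last first.
      move=> i; rewrite inE a_gt0 negbK => /eqP iS.
      by rewrite /a iS cards0 mul0r.
    by rewrite -sumr_const; apply: ler_sum.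
  rewrite sum_a => le; have {}A_large : m%:R - 2^-1 + p%:R^-1 <= #|S|%:R :> rat.
    by apply: le_trans le; rewrite ler_pdivlMr.
  have : m%:R < #|S|.+1%:R :> rat.
    rewrite -natr1; have : 0 < p%:R^-1 :> rat by rewrite invr_gt0.
    lra.
  by rewrite ltr_nat.
have [k k0 Sk] := sum_free_extremal p_prime pm S_sum_free mS.
have [w wk] := dot_surj k u0.
exists (hyperplane u), w; split.
- exact: dim_hyperplane.
- by rewrite mem_hyperplane wk.
move=> x xA; have xS : dot u x \in S.
  by rewrite inE a_gt0; apply/set0Pn; exists x; rewrite in_slice xA eqxx.
have [j jm xj] := Sk _ xS.
exists j, (x - w *+ j); split=> //; last by rewrite addrC subrK.
by rewrite mem_hyperplane dotB dotMn wk xj subrr.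
Qed.
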